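(* Let $(\mu_1,\mu_2)=\mathcal{N}(\sigma_1,\sigma_2)$ be a Nikishin system on closed intervals $\Gamma_1,\Gamma_2$, and for $\boldsymbol{n}=(n_1,n_2)\in\mathbb{N}^2\setminus\{\boldsymbol{0}\}$ let $(A^{(1)}_{\boldsymbol{n}},A^{(2)}_{\boldsymbol{n}})$ be its type I multiple orthogonal polynomials. Let $\mathring{\Gamma}_2$ denote the interior of $\Gamma_2$ in $\mathbb{R}$. (i) If $n_1+1\le n_2$ and $n_1\neq 0$, then $A^{(1)}_{\boldsymbol{n}}$ is real-rooted, all its zeros lie in $\mathring{\Gamma}_2$, and each zero is simple. (ii) If $n_1+1\ge n_2$ and $n_2\ne 0$, then $A^{(2)}_{\boldsymbol{n}}$ is real-rooted, all its zeros lie in $\mathring{\Gamma}_2$, and each zero is simple.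
   Context: $\mathbb{N}=\{0,1,2,\dots\}$, $|\boldsymbol{n}|=n_1+n_2$. For $\Gamma\subseteq\mathbb{R}$, $\mathcal{M}(\Gamma)$ is the set of finite Borel measures of constant sign (positive or negative) with all moments finite and with infinite support contained in $\Gamma$. For a measure $\sigma$, $m_\sigma(z)=\int\frac{d\sigma(x)}{x-z}$. The pair $(\mu_1,\mu_2)\in\mathcal{M}(\mathbb{R})^2$ is a Nikishin system generated by $(\sigma_1,\sigma_2)$, written $(\mu_1,\mu_2)=\mathcal{N}(\sigma_1,\sigma_2)$, if there are closed intervals $\Gamma_1,\Gamma_2\subseteq\mathbb{R}$ with disjoint interiors and $\sigma_j\in\mathcal{M}(\Gamma_j)$ such that $\mu_1=\sigma_1$ and $d\mu_2(x)=m_{\sigma_2}(x)\,d\sigma_1(x)$. (If $\Gamma_1,\Gamma_2$ share an endpoint, it is part of the assumption that the latter defines a finite measure.) Nikishin systems are known to be perfect, i.e. for every $\boldsymbol{n}\in\mathbb{N}^2$ there is a unique monic polynomial $P_{\boldsymbol{n}}$ of degree $|\boldsymbol{n}|$ with $\int P_{\boldsymbol{n}}(x)x^k\,d\mu_j(x)=0$ for $0\le k\le n_j-1$, $j=1,2$; equivalently, for $\boldsymbol{n}\ne\boldsymbol{0}$, the type I polynomials exist and are unique. The type I multiple orthogonal polynomial at $\boldsymbol{n}\neq\boldsymbol{0}$ is the non-zero vector $(A^{(1)}_{\boldsymbol{n}},A^{(2)}_{\boldsymbol{n}})$ with $\deg A^{(j)}_{\boldsymbol{n}}\le n_j-1$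 (so $A^{(j)}_{\boldsymbol{n}}=0$ if $n_j=0$) and $\sum_{j=1}^2\int A^{(j)}_{\boldsymbol{n}}(x)x^k\,d\mu_j(x)$ equal to $0$ for $k=0,\dots,|\boldsymbol{n}|-2$ and to $1$ for $k=|\boldsymbol{n}|-1$. A polynomial is real-rooted if all its complex zeros are real. *)

(* Defs.v *)
From HB Require Import structures.
From mathcomp Require Import all_boot all_order all_algebra.
From mathcomp Require Import complex.
From mathcomp Require Import all_classical all_reals all_analysis.

Set Implicit Arguments.
Unset Strict Implicit.
Unset Printing Implicit Defensive.
Import Order.TTheory GRing.Theory Num.Theory.
Import numFieldNormedType.Exports.
Local Open Scope classical_set_scope.
Local Open Scope ring_scope.

(* A finite Borel measure of constant sign on R, given as (-1) ^+ csm_neg times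
   the finite nonnegative measure csm_abs. *)
Record csmeasure (R : realType) := CSMeasure {
  csm_neg : bool;
  csm_abs : {finite_measure set (measurableTypeR R) -> \bar R}
}.

Definition csm_sign (R : realType) (mu : csmeasure R) : R := (-1) ^+ csm_neg mu.

Definition csm_val (R : realType) (mu : csmeasure R)
    (A : set (measurableTypeR R)) : \bar R :=
  ((csm_sign mu)%:E * csm_abs mu A)%E.

(* Real-valued: meaningful only when f is integrable against csm_abs mu
   (Rintegral is 0 when the extended integral is infinite). *)
Definition csm_int (R : realType) (mu : csmeasure R)
    (D : set (measurableTypeR R)) (f : R -> R) : R :=
  csm_sign mu * \int[csm_abs mu]_(x in D) f x.

Definition csm_support (R : realType) (mu : csmeasure R) : set R :=
  [set x | forall U : set R, open U -> U x -> (0 < csm_abs mu U)%E].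

(* The class M(Gamma): all moments finite, infinite support inside Gamma. *)
Definition csm_class (R : realType) (Gamma : set R) (mu : csmeasure R) : Prop :=
  [/\ forall k : nat,
        (csm_abs mu).-integrable setT (fun x : R => (x ^+ k)%:E),
      infinite_set (csm_support mu) &
      csm_support mu `<=` Gamma].

(* The integral defining m_sigma(z) converges absolutely. The atom condition is
   needed because 0^-1 = 0 in MathComp: without it an atom of sigma at z, which
   makes the integral diverge, would go unnoticed. *)
Definition cauchy_defined (R : realType) (sigma : csmeasure R) (z : R) : Prop :=
  csm_abs sigma [set z] = 0%E /\
  (csm_abs sigma).-integrable setT (fun x : R => ((x - z)^-1)%:E).

Definition cauchy_transform (R : realType) (sigma : csmeasure R) (z : R) : R :=
  csm_int sigma setT (fun x => (x - z)^-1).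

(* The last three clauses say that m_sigma2 d(sigma1) is a well-defined finite
   measure and that mu2 is this measure. The a.e. clause and the integrability
   clause are automatic unless Gamma1 and Gamma2 share an endpoint. *)
Definition nikishin (R : realType) (Gamma1 Gamma2 : set R)
    (sigma1 sigma2 mu1 mu2 : csmeasure R) : Prop :=
  [/\ is_interval Gamma1 /\ closed Gamma1,
      is_interval Gamma2 /\ closed Gamma2,
      interior Gamma1 `&` interior Gamma2 = set0,
      csm_class Gamma1 sigma1 /\ csm_class Gamma2 sigma2 &
      csm_class setT mu1 /\ csm_class setT mu2] /\
  [/\ forall A : set (measurableTypeR R), measurable A ->
        csm_val mu1 A = csm_val sigma1 A,
      {ae csm_abs sigma1, forall z : R, cauchy_defined sigma2 z},
      (csm_abs sigma1).-integrable setT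
        (fun z : R => (cauchy_transform sigma2 z)%:E) &
      forall A : set (measurableTypeR R), measurable A ->
        csm_val mu2 A = (csm_int sigma1 A (cauchy_transform sigma2))%:E].

Definition type1_moment (R : realType) (mu1 mu2 : csmeasure R)
    (A1 A2 : {poly R}) (k : nat) : R :=
  csm_int mu1 setT (fun x => A1.[x] * x ^+ k) +
  csm_int mu2 setT (fun x => A2.[x] * x ^+ k).

Definition type1_mop (R : realType) (mu1 mu2 : csmeasure R) (n1 n2 : nat)
    (A1 A2 : {poly R}) : Prop :=
  [/\ (A1, A2) != (0, 0),
      (size A1 <= n1)%N,
      (size A2 <= n2)%N,
      forall k : nat, (k.+1 < n1 + n2)%N -> type1_moment mu1 mu2 A1 A2 k = 0 &
      type1_moment mu1 mu2 A1 A2 (n1 + n2).-1 = 1].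

Definition complexify (R : realType) (p : {poly R}) : {poly R[i]} :=
  map_poly (real_complex R) p.

Definition real_rooted (R : realType) (p : {poly R}) : Prop :=
  forall z : R[i], root (complexify p) z -> exists x : R, z = real_complex R x.

Definition simple_real_zeros_in (R : realType) (E : set R) (p : {poly R}) : Prop :=
  [/\ real_rooted p,
      forall z : R[i], root (complexify p) z ->
        exists2 x : R, E x & z = real_complex R x &
      forall z : R[i], root (complexify p) z -> mup z (complexify p) = 1%N].

(* Main.v *)
Require Import Defs.
From mathcomp Require Import all_boot all_order all_algebra.
From mathcomp Require Import complex.
From mathcomp Require Import all_classical all_reals all_analysis.
From mathcomp Require Import measurable_realfun.
From mathcomp Require Import ring lra zify.
Import numFieldNormedType.Exports.

(** Put [N = n1 + n2 - 1] and [F = A1 + A2 m], [m] the Cauchy transform of [sigma2]. Orthogonality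
    of [F] to the polynomials of degree below [N] with respect to [sigma1] gives [F] at least [N]
    zeros [x_1, ..., x_N] in [Gamma1]; let [Q] be the monic polynomial with these zeros. It has
    constant sign on the interior of [Gamma2], so [g |-> int g / Q dsigma2] is a definite
    functional and [m (x_j)] is its value at [Q / (X - x_j)]. A Gauss quadrature with [N + 1] nodes replaces
    [sigma2] by a discrete measure without changing these values: [m (x_j) = - E (x_j) / D (x_j)],
    where [D] has the nodes as its zeros and the residues of [E / D] have constant sign. Hence
    [A1 D - A2 E = K Q] with a remainder [K] of small degree. Evaluating at the zeros of [D]
    eliminates [A1] and leaves discrete orthogonality relations for [A2], which force the zeros
    of [A2] into the interior of [Gamma2]. The zeros of [E] interlace those of [D], and evaluating
    at them gives the same conclusion for [A1]. *)

Set Implicit Arguments.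
Unset Strict Implicit.
Unset Printing Implicit Defensive.
Import Order.TTheory GRing.Theory Num.Theory.
Local Open Scope ring_scope.

(** * Nodal polynomials and Lagrange interpolation *)

Definition nodal (R : nzRingType) (T : seq R) : {poly R} :=
  \prod_(u <- T) ('X - u%:P).

(** For [t] in a duplicate-free [T], [(nodal_but T t).[t]] is the derivative of [nodal T] at [t],
    the denominator in the Lagrange and partial fraction formulas. *)
Definition nodal_but (R : nzRingType) (T : seq R) (t : R) : {poly R} :=
  \prod_(u <- T | u != t) ('X - u%:P).

Section Nodal.
Variable R : fieldType.
Implicit Types (T : seq R) (t u : R) (g : {poly R}).

Lemma nodal_monic T : nodal T \is monic.
Proof. exact: monic_prod_XsubC. Qed.

Lemma size_nodal T : size (nodal T) = (size T).+1.
Proof. exact: size_prod_XsubC. Qed.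

Lemma root_nodal T t : root (nodal T) t = (t \in T).
Proof. exact: root_prod_XsubC. Qed.

Lemma nodal_butE T t : uniq T -> t \in T ->
  nodal T = nodal_but T t * ('X - t%:P).
Proof. by move=> uT tT; rewrite /nodal (bigD1_seq t)//= mulrC. Qed.

Lemma nodal_but_monic T t : nodal_but T t \is monic.
Proof. exact: monic_prod_XsubC. Qed.

Lemma size_nodal_but T t : uniq T -> t \in T ->
  size (nodal_but T t) = size T.
Proof.
move=> uT tT; apply: succn_inj; rewrite -size_nodal (nodal_butE uT tT).
by rewrite size_Mmonic ?monicXsubC ?monic_neq0 ?nodal_but_monic// size_XsubC addn2.
Qed.

Lemma root_nodal_but T t u : root (nodal_but T t) u = (u \in T) && (u != t).
Proof.
by rewrite /nodal_but -big_filter root_prod_XsubC mem_filter andbC.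
Qed.

Lemma eq0_of_many_roots T g : uniq T -> (size g <= size T)%N ->
  (forall t, t \in T -> g.[t] = 0) -> g = 0.
Proof.
move=> uT sg gT; apply/eqP; apply: contraTT sg => g0; rewrite -ltnNge.
by apply: max_poly_roots => //; apply/allP => t /gT /eqP.
Qed.

Lemma lagrange T g : uniq T -> (size g <= size T)%N ->
  g = \sum_(t <- T) (g.[t] / (nodal_but T t).[t]) *: nodal_but T t.
Proof.
move=> uT sg; apply/eqP; rewrite -subr_eq0; apply/eqP.
apply: (eq0_of_many_roots uT) => [|t tT].
  rewrite (leq_trans (size_polyD _ _))// geq_max sg size_polyN.
  rewrite big_seq; apply: (leq_trans (size_sum _ _ _)).
  apply/bigmax_leqP_seq => u uinT _.
  by rewrite (leq_trans (size_scale_leq _ _))// size_nodal_but.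
rewrite hornerD hornerN horner_sum (bigD1_seq t)//= big1 ?addr0.
  rewrite hornerZ divfK ?subrr//.
  by have := root_nodal_but T t t; rewrite eqxx andbF => /negbT.
move=> u ut; rewrite hornerZ.
have /rootP -> : root (nodal_but T u) t by rewrite root_nodal_but tT eq_sym.
by rewrite mulr0.
Qed.

(** Compare coefficients of degree [size T - 1] in the Lagrange formula: each [nodal_but T t] is
    monic of that degree, and [g] has smaller degree. *)
Lemma lagrange_sum0 T g : uniq T -> (size g < size T)%N ->
  \sum_(t <- T) g.[t] / (nodal_but T t).[t] = 0.
Proof.
move=> uT sg; have := congr1 (fun p : {poly R} => p`_(size T).-1) (lagrange uT (ltnW sg)).
rewrite nth_default; last by rewrite -ltnS prednK// (leq_ltn_trans _ sg).
move=> c0; rewrite [RHS]c0 coef_sum big_seq [RHS]big_seq; apply: eq_bigr => t tT.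
rewrite coefZ -[in RHS](size_nodal_but uT tT).
by have /monicP := nodal_but_monic T t; rewrite /lead_coef => ->; rewrite mulr1.
Qed.

Lemma nodal_but_neq0 T t : (nodal_but T t).[t] != 0.
Proof. by have := root_nodal_but T t t; rewrite eqxx andbF => /negbT. Qed.

Lemma dvd_nodal T g : uniq T -> (forall t, t \in T -> g.[t] = 0) ->
  exists h, g = h * nodal T.
Proof.
move=> uT gT; have /dvdpP[h ->] : nodal T %| g; last by exists h.
by rewrite /nodal uniq_roots_dvdp ?uniq_rootsE//; apply/allP => t /gT /eqP.
Qed.

Lemma factor_of_roots T g : uniq T -> g != 0 -> (size g <= (size T).+1)%N ->
  (forall t, t \in T -> g.[t] = 0) -> exists2 c, c != 0 & g = c *: nodal T.
Proof.
move=> uT g0 sg /(dvd_nodal uT)[h gE]; move: g0 sg; rewrite gE => g0.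
have h0 : h != 0 by apply: contraNneq g0 => ->; rewrite mul0r.
rewrite size_Mmonic ?nodal_monic// size_nodal => sh.
have /eqP/size_poly1P[c c0 ->] : size h = 1%N.
  apply/eqP; rewrite eqn_leq size_poly_gt0 h0 andbT.
  by move: sh; rewrite addnS -[X in (_ <= X)%N]addn1 addnC leq_add2l.
by exists c => //; rewrite mul_polyC.
Qed.

End Nodal.

(** * Polynomials that match the sign changes of a function *)

Section SignChanges.
Variable R : realFieldType.
Implicit Types (S : R -> Prop) (F : R -> R) (l : seq R).

(* A root [z] of [F] is kept as a factor of [q] exactly when [F] changes sign across it, so that
   the induction needs no ordering of [l]. *)
Lemma sign_poly l S F :
  (forall z, z \in l -> F z = 0) ->
  (forall a b, S a -> S b -> a < b -> (forall z, z \in l -> ~~ (a <= z <= b)) ->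
    F a != 0 -> F b != 0 -> 0 < F a * F b) ->
  exists q : {poly R}, [/\ q != 0, (size q <= (size l).+1)%N,
    forall x, root q x -> x \in l & forall x, S x -> 0 <= F x * q.[x]].
Proof.
elim: l F => [|z l IH] F Fl HF.
  have H a b : S a -> S b -> F a != 0 -> 0 <= F b * F a.
    move=> Sa Sb Fa; have [->|Fb] := eqVneq (F b) 0; first by rewrite mul0r.
    have [ab|ba|<-] := ltgtP a b; last by rewrite -expr2 sqr_ge0.
      by rewrite mulrC; apply/ltW/HF.
    by apply/ltW/HF.
  case: (pselect (exists a, S a /\ F a != 0)) => [[a [Sa Fa]]|nF].
    exists (F a)%:P; split=> [||x|x Sx]; rewrite ?polyC_eq0 ?rootC ?(negPf Fa)//.
      by rewrite size_polyC Fa.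
    by rewrite hornerC; exact: H.
  exists 1%:P; split=> [||x|x Sx]; rewrite ?polyC_eq0 ?size_polyC ?rootC ?oner_eq0//.
  rewrite hornerC mulr1; have [->//|Fx] := eqVneq (F x) 0.
  by case: nF; exists x.
have Fl' w : w \in l -> F w = 0 by move=> wl; apply: Fl; rewrite inE wl orbT.
have Fz : F z = 0 by apply: Fl; rewrite mem_head.
(* Does [F] change sign across [z], with no other listed zero between the witnesses? If not, the
   induction hypothesis applies to [F] itself. *)
case: (pselect (exists a b, [/\ S a, S b, a <= z <= b,
   (forall w, w \in l -> ~~ (a <= w <= b)) & F a * F b < 0])); last first.
  move=> nE; have [//|a b Sa Sb ab abl Fa Fb|q [q0 sq rq Fq]] := IH F.
    have [zab|nzab] := boolP (a <= z <= b); last first.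
      by apply: HF => // w; rewrite inE => /orP[/eqP->|]; last exact: abl.
    rewrite lt_neqAle eq_sym mulf_neq0//= leNgt; apply/negP => FF.
    by apply: nE; exists a, b.
  exists q; split=> // [|x /rq xl]; first exact: (leq_trans sq).
  by rewrite inE xl orbT.
have neqz c : F c != 0 -> c != z by apply: contraNneq => ->; rewrite Fz.
case=> a [b [Sa Sb /andP[az zb] abl Fab]].
have Fa : F a != 0 by apply: contraTneq Fab => ->; rewrite mul0r ltxx.
have Fb : F b != 0 by apply: contraTneq Fab => ->; rewrite mulr0 ltxx.
have {}az : a < z by rewrite lt_neqAle neqz.
have {}zb : z < b by rewrite lt_neqAle eq_sym neqz.
have side c d : S c -> S d -> F c != 0 -> F d != 0 ->
    (forall w, w \in z :: l -> ~~ (Num.min c d <= w <= Num.max c d)) ->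
    0 < F c * F d.
  move=> Sc Sd Fc Fd; have [cd|dc|<-] := ltgtP c d => h; first exact: HF.
    by rewrite mulrC; exact: HF.
  by rewrite -expr2 exprn_even_gt0.
(* Otherwise the change at [z] is undone by the factor [x - z], and [z] becomes a root of the final
   polynomial. *)
have [w wl|a' b' Sa' Sb' ab' ab'l|q [q0 sq rq Fq]] := IH (fun x => F x * (x - z)).
- by rewrite Fl' ?mul0r.
- rewrite !mulf_eq0 !negb_or !subr_eq0 => /andP[Fa' a'z] /andP[Fb' b'z].
  have [/andP[a'z' zb']|nz] := boolP (a' <= z <= b'); last first.
    have h : 0 < F a' * F b'.
      by apply: HF => // w; rewrite inE => /orP[/eqP->|]; last exact: ab'l.
    rewrite mulrACA pmulr_rgt0//.
    have [a'ltz|zlta'|E] := ltgtP a' z; last by rewrite E eqxx in a'z.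
      rewrite nmulr_rgt0 subr_lt0//; rewrite ltNge.
      by move: nz; rewrite (ltW a'ltz).
    by rewrite mulr_gt0// subr_gt0// (lt_trans zlta').
  have {}a'z' : a' < z by rewrite lt_neqAle a'z.
  have {}zb' : z < b' by rewrite lt_neqAle eq_sym b'z.
  (* A listed zero between [a'] and [a], or between [b] and [b'], would lie in one of the segments
     from [a] to [b] and from [a'] to [b']. So [F] changes sign from [a'] to [b'] as it does from
     [a] to [b]. *)
  have aa : 0 < F a' * F a.
    apply: side => // w; rewrite inE => /orP[/eqP->|wl].
      by rewrite le_max (lt_geF a'z') (lt_geF az) andbF.
    apply/negP => /andP[]; rewrite ge_min le_max => /orP[] h1 /orP[] h2.
    - by rewrite (le_anti (introT andP (conj h1 h2))) Fl' ?eqxx // in Fa'.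
    - by have /negP[] := ab'l _ wl; rewrite h1 /= (le_trans h2)// ltW// (lt_trans az).
    - by have /negP[] := abl _ wl; rewrite h1 /= (le_trans h2)// ltW// (lt_trans a'z').
    - by rewrite (le_anti (introT andP (conj h1 h2))) Fl' ?eqxx // in Fa.
  have bb : 0 < F b * F b'.
    apply: side => // w; rewrite inE => /orP[/eqP->|wl].
      by rewrite ge_min (lt_geF zb') (lt_geF zb).
    apply/negP => /andP[]; rewrite ge_min le_max => /orP[] h1 /orP[] h2.
    - by rewrite (le_anti (introT andP (conj h1 h2))) Fl' ?eqxx // in Fb.
    - have /negP[] := ab'l _ wl; rewrite h2 andbT (le_trans _ h1)// ltW//.
      exact: lt_trans zb.
    - have /negP[] := abl _ wl; rewrite h2 andbT (le_trans _ h1)// ltW//.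
      exact: lt_trans zb'.
    - by rewrite (le_anti (introT andP (conj h1 h2))) Fl' ?eqxx // in Fb'.
  have ab0 : F a' * F b' < 0.
    by have := mulr_gt0 aa bb; rewrite [F b * _]mulrC mulrACA nmulr_lgt0.
  by rewrite mulrACA nmulr_rgt0// nmulr_rlt0 ?subr_lt0// subr_gt0.
- exists (q * ('X - z%:P)); split=> [||x|x Sx].
  + by rewrite mulf_neq0 ?polyXsubC_eq0.
  + by rewrite size_Mmonic ?monicXsubC// size_XsubC addn2.
  + by rewrite rootM root_XsubC inE => /orP[/rq->|->]; rewrite ?orbT.
  + by rewrite hornerM hornerXsubC mulrA mulrAC; exact: Fq.
Qed.

(** The dichotomy behind the zero counts below: the second case gives a [q] of small degree with
    [F * q] nonnegative, which orthogonality will refute. The list of all zeros serves to make the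
    corresponding integral strictly positive. *)
Lemma zeros_or_sign_poly k S F :
  (forall a b, S a -> S b -> a < b -> F a * F b < 0 ->
     exists z, [/\ a <= z <= b, S z & F z = 0]) ->
  (exists l, [/\ uniq l, size l = k & forall z, z \in l -> S z /\ F z = 0]) \/
  (exists q : {poly R}, [/\ q != 0, (size q <= k)%N,
    forall x, root q x -> S x /\ F x = 0, forall x, S x -> 0 <= F x * q.[x] &
    exists l : seq R, forall x, S x -> F x = 0 -> x \in l]).
Proof.
move=> ivt.
have [[l []]|[l [ul sl lF Fl]]] :
  (exists l, [/\ uniq l, size l = k & forall z, z \in l -> S z /\ F z = 0])
  \/ (exists l, [/\ uniq l, (size l < k)%N, (forall z, z \in l -> S z /\ F z = 0) &
       forall x, S x -> F x = 0 -> x \in l]).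
- elim: k => [|k [[l [ul sl lF]]|[l [ul sl lF Fl]]]]; first by left; exists [::].
    case: (pselect (exists x, [/\ S x, F x = 0 & x \notin l])) => [[x [Sx Fx xl]]|nx].
      left; exists (x :: l); split=> [||z] /=; rewrite ?ul ?xl ?sl//.
      by rewrite inE => /orP[/eqP->//|/lF].
    right; exists l; split=> // [|x Sx Fx]; first by rewrite sl.
    by apply/negPn/negP => xl; apply: nx; exists x.
  by right; exists l; split=> //; exact: ltnW.
- by move=> *; left; exists l.
right; have [z /lF[]//|a b Sa Sb ab abl Fa Fb|q [q0 sq rq Fq]] := @sign_poly l S F.
  rewrite lt_neqAle eq_sym mulf_neq0//= leNgt; apply/negP => FF.
  have [z [zab Sz Fz]] := ivt _ _ Sa Sb ab FF.
  by have /negP := abl z (Fl _ Sz Fz).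
exists q; split=> //; [exact: leq_trans sl|by move=> x /rq/lF|by exists l].
Qed.

End SignChanges.

(** * Zero counts from discrete orthogonality, and Gauss quadrature *)

Section Quadrature.
Variables (R : rcfType) (J : R -> Prop).
Hypothesis Jconv : forall a b z, J a -> J b -> a <= z <= b -> J z.
Implicit Types (T : seq R) (V K g : {poly R}).

Lemma horner_zeros_or_sign_poly k V :
  (exists l, [/\ uniq l, size l = k & forall z, z \in l -> J z /\ V.[z] = 0]) \/
  (exists q : {poly R}, [/\ q != 0, (size q <= k)%N,
    forall x, root q x -> J x /\ V.[x] = 0 & forall x, J x -> 0 <= V.[x] * q.[x]]).
Proof.
have [a b Ja Jb ab VV|H|[q [q0 sq rq Vq _]]] :=
    @zeros_or_sign_poly R k J (horner V); [|by left|by right; exists q].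
have Vb : V.[b] != 0 by apply: contraTneq VV => ->; rewrite mulr0 ltxx.
have [|z zab] := @poly_ivt R (V * V.[b]%:P) a b (ltW ab).
  by rewrite !hornerM !hornerC -expr2 sqr_ge0 andbT ltW.
rewrite rootM rootC (negPf Vb) orbF => /rootP Vz.
by exists z; split=> //; exact: Jconv zab.
Qed.

(* The identity [\sum_t g.[t] / D'(t) = 0] applied to [g := K * q] plays the role of the
   orthogonality relations, [K] being known to have small degree. *)
Lemma zeros_of_nodes T V K (y : R -> R) (s : R) k : uniq T ->
  (forall t, t \in T -> J t) -> V != 0 -> (size V <= size T)%N ->
  (forall t, t \in T -> V.[t] * y t = K.[t]) ->
  (forall t, t \in T -> 0 < s * (y t * (nodal_but T t).[t])) ->
  (K = 0 \/ (size K + k <= size T)%N) ->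
  exists l, [/\ uniq l, size l = k & forall z, z \in l -> J z /\ V.[z] = 0].
Proof.
move=> uT TJ V0 sV VK ys sK.
have [//|[q [q0 sq rq Vq]]] := horner_zeros_or_sign_poly k V.
have T0 : (0 < size T)%N by rewrite (leq_trans _ sV)// size_poly_gt0.
have sKq : (size (K * q)%R < size T)%N.
  case: sK => [->|sK]; first by rewrite mul0r size_poly0.
  apply: (leq_trans _ sK); rewrite (leq_ltn_trans (size_polyMleq _ _))//.
  move: q0; rewrite -size_poly_gt0; case: (size q) sq => // n nk _.
  by rewrite addnS /= ltn_add2l.
have := lagrange_sum0 uT sKq => /(congr1 (fun x => s * x)).
rewrite mulr0 mulr_sumr => /eqP.
have E t : t \in T -> s * ((K * q).[t] / (nodal_but T t).[t]) =
    V.[t] * q.[t] * (s * (y t * (nodal_but T t).[t])) / (nodal_but T t).[t] ^+ 2.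
  by move=> tT; rewrite hornerM -VK//; field; exact: nodal_but_neq0.
rewrite big_seq (eq_bigr _ E) -big_seq big_seq_cond psumr_eq0; last first.
  move=> t; rewrite andbT => tT.
  have := Vq _ (TJ _ tT) => Vqt.
  by apply: mulr_ge0; [rewrite mulr_ge0// ltW// ys|rewrite invr_ge0 sqr_ge0].
(* All terms of the sum vanish. A root of [q] is a zero of [V], so [V] vanishes at every node, more
   often than its degree allows. *)
move=> /allP H; move: V0; rewrite (@eq0_of_many_roots R T V) ?eqxx// => t tT.
have := H t tT; rewrite tT /= mulf_eq0 invr_eq0 expf_eq0 (negPf (nodal_but_neq0 _ _)).
rewrite andbF orbF mulf_eq0 (gt_eqF (ys _ tT)) orbF mulf_eq0 => /orP[/eqP//|/rq[]//].
Qed.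

Variable L : {poly R} -> R.
Hypothesis Llin : forall (a : R) (f g : {poly R}), L (a *: f + g) = a * L f + L g.
Hypothesis Lpos : forall g, g != 0 -> (forall t, J t -> 0 <= g.[t]) -> 0 < L g.

Lemma functional0 : L 0 = 0.
Proof.
have := Llin 1 0 0; rewrite scaler0 addr0 mul1r => /eqP.
by rewrite -subr_eq subrr eq_sym => /eqP.
Qed.

Lemma functionalD f g : L (f + g) = L f + L g.
Proof. by have := Llin 1 f g; rewrite scale1r mul1r. Qed.

Lemma functionalZ a f : L (a *: f) = a * L f.
Proof. by have := Llin a f 0; rewrite functional0 !addr0. Qed.

Lemma functional_sum (I : Type) (r : seq I) (P : pred I) (c : I -> R) (f : I -> {poly R}) :
  L (\sum_(i <- r | P i) c i *: f i) = \sum_(i <- r | P i) c i * L (f i).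
Proof.
apply: (big_ind2 (fun p x => L p = x)); first exact: functional0.
  by move=> p x q y <- <-; rewrite functionalD.
by move=> i _; rewrite functionalZ.
Qed.

(** The moment matrix has one more row than columns, hence a nonzero left kernel vector; its entries
    are the coefficients of [D]. *)
Lemma exists_orthogonal_poly M : exists D : {poly R}, [/\ D != 0,
  (size D <= M.+1)%N & forall q : {poly R}, (size q <= M)%N -> L (D * q) = 0].
Proof.
pose A := \matrix_(i < M.+1, k < M) L ('X^i * 'X^k).
have kA : kermx A != 0.
  by rewrite kermx_eq0 /row_free neq_ltn (leq_ltn_trans (rank_leq_col A)).
have /rowV0Pn[v /sub_kermxP vA v0] := kA.
exists (rVpoly v); split=> [||q sq].
- by apply: contraNneq v0 => v0; rewrite -[v]rVpolyK v0 linear0.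
- exact: size_poly.
have DE : rVpoly v = \sum_(i < M.+1) v 0 i *: 'X^i.
  apply/polyP => k; rewrite coef_rVpoly coef_sum; case: insubP => [i _ <-|kM].
    rewrite (bigD1 i)//= coefZ coefXn eqxx mulr1 big1 ?addr0// => j ji.
    by rewrite coefZ coefXn eq_sym (inj_eq val_inj) (negPf ji) mulr0.
  rewrite big1// => j _; rewrite coefZ coefXn; case: eqP => [kj|]; rewrite ?mulr0//.
  by rewrite kj ltn_ord in kM.
have qE : q = \sum_(k < M) q`_k *: 'X^k.
  rewrite -[LHS]coefK poly_def (big_ord_widen _ (fun k => q`_k *: 'X^k) sq).
  rewrite big_mkcond; apply: eq_bigr => k _; case: ltnP => // h.
  by rewrite nth_default// scale0r.
rewrite qE mulr_sumr; under eq_bigr do rewrite -scalerAr.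
rewrite functional_sum big1// => k _; rewrite DE mulr_suml.
under eq_bigr do rewrite -scalerAl; rewrite functional_sum.
have := congr1 (fun u : 'rV_M => u 0 k) vA; rewrite !mxE => E.
by apply/eqP; rewrite mulf_eq0; apply/orP; right; apply/eqP; rewrite -[RHS]E;
  apply: eq_bigr => i _; rewrite mxE.
Qed.

(** The nodes are the zeros of an orthogonal polynomial. Division by [nodal T] leaves a quotient
    killed by orthogonality and a remainder handled by Lagrange interpolation. *)
Lemma gauss_quadrature M : exists T, exists w : R -> R, [/\ uniq T, size T = M,
  forall t, t \in T -> J t /\ 0 < w t &
  forall g, (size g <= M + M)%N -> L g = \sum_(t <- T) w t * g.[t]].
Proof.
have [D [D0 sD LD0]] := exists_orthogonal_poly M.
(* With fewer than [M] zeros in [J], some nonzero [q] of size at most [M] makes [D * q] nonnegative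
   on [J], against [L (D * q) = 0]. *)
have [[T [uT sT TD]]|[q [q0 sq rq Dq]]] := horner_zeros_or_sign_poly M D; last first.
  have := @Lpos (D * q); rewrite mulf_neq0// LD0// ltxx => H; exfalso.
  by apply/negP: isT; apply: H => // t Jt; rewrite hornerM Dq.
have [||c c0 DE] := @factor_of_roots R T D uT D0.
  by rewrite sT.
  by move=> t /TD[].
have quad g : (size g <= M + M)%N ->
    L g = \sum_(t <- T) (L (nodal_but T t) / (nodal_but T t).[t]) * g.[t].
  move=> sg; rewrite {1}(divp_eq g (nodal T)).
  set h := g %/ _; set r := g %% _.
  have -> : h * nodal T = c^-1 *: (D * h) by rewrite DE -scalerAl scalerA mulVf// scale1r mulrC.
  rewrite functionalD functionalZ LD0 ?mulr0 ?add0r; last first.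
    by rewrite /h size_divp ?monic_neq0 ?nodal_monic// size_nodal sT leq_subLR.
  have sr : (size r <= size T)%N.
    by rewrite -ltnS -(size_nodal T) ltn_modp monic_neq0// nodal_monic.
  rewrite {1}(lagrange uT sr) functional_sum big_seq [RHS]big_seq; apply: eq_bigr => t tT.
  suff -> : r.[t] = g.[t] by rewrite mulrAC [RHS]mulrC mulrA mulrAC -mulrA mulrC.
  rewrite (divp_eq g (nodal T)) -/h -/r hornerD hornerM.
  by have /rootP -> : root (nodal T) t; rewrite ?root_nodal// mulr0 add0r.
exists T, (fun t => L (nodal_but T t) / (nodal_but T t).[t]); split=> // t tT.
split; first by have [] := TD _ tT.
have nn : nodal_but T t != 0 by rewrite monic_neq0// nodal_but_monic.
(* The rule is exact on this square, which vanishes at all nodes but [t]; this isolates the weight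
   at [t]. *)
have : 0 < L (nodal_but T t ^+ 2).
  by apply: Lpos => [|x _]; rewrite ?expf_neq0// horner_exp sqr_ge0.
rewrite quad; last first.
  rewrite (leq_trans (size_poly_exp_leq _ _))// size_nodal_but// sT.
  have : (0 < M)%N by rewrite -sT; case: (T) tT.
  lia.
rewrite (bigD1_seq t)//= big_seq_cond big1 ?addr0 => [|u /andP[uinT ut]]; last first.
  have /rootP nu : root (nodal_but T t) u by rewrite root_nodal_but uinT.
  by rewrite horner_exp nu expr0n mulr0.
by rewrite horner_exp pmulr_lgt0// exprn_even_gt0//= nodal_but_neq0.
Qed.

End Quadrature.

(** * Numerators of discrete Cauchy transforms and their zeros *)

Section Nodes.
Variable R : rcfType.
Implicit Types (T : seq R) (W : R -> R).

(* The numerator of [\sum_(t <- T) W t / ('X - t)] over the denominator [nodal T]. *)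
Definition second_kind T W : {poly R} := \sum_(t <- T) W t *: nodal_but T t.

Lemma size_second_kind T W : uniq T -> (size (second_kind T W) <= size T)%N.
Proof.
move=> uT; rewrite /second_kind big_seq; apply: (leq_trans (size_sum _ _ _)).
apply/bigmax_leqP_seq => u uinT _.
by rewrite (leq_trans (size_scale_leq _ _))// size_nodal_but.
Qed.

Lemma second_kind_node T W t : uniq T -> t \in T ->
  (second_kind T W).[t] = W t * (nodal_but T t).[t].
Proof.
move=> uT tT; rewrite horner_sum (bigD1_seq t)//= hornerZ big1 ?addr0// => u ut.
rewrite hornerZ; have /rootP -> : root (nodal_but T u) t by rewrite root_nodal_but tT eq_sym.
by rewrite mulr0.
Qed.

(** This is the derivative of [\sum_(t <- T) W t / ('X - t)], multiplied by [nodal T ^+ 2]. *)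
Lemma wronskian_second_kind T W : uniq T ->
  (second_kind T W)^`() * nodal T - second_kind T W * (nodal T)^`() =
  - \sum_(t <- T) W t *: nodal_but T t ^+ 2.
Proof.
move=> uT; rewrite /second_kind raddf_sum !mulr_suml -sumrB -sumrN /=.
rewrite big_seq [RHS]big_seq; apply: eq_bigr => t tT.
rewrite derivZ -!scalerAl -scalerBr -scalerN; congr (_ *: _).
rewrite (nodal_butE uT tT) derivM derivXsubC; ring.
Qed.

(** At the nodes the numerator has the signs of [(nodal_but T t).[t]], which alternate; its degree
    leaves no room for further zeros. *)
Lemma second_kind_roots (J : R -> Prop) T W : (0 < size T)%N ->
  (forall a b z, J a -> J b -> a <= z <= b -> J z) ->
  uniq T -> (forall t, t \in T -> J t /\ 0 < W t) ->
  exists (e : R) (U : seq R), [/\ e != 0, uniq U, size U = (size T).-1,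
    forall u, u \in U -> J u & second_kind T W = e *: nodal U].
Proof.
move=> T0 Jconv uT TW; set E := second_kind T W.
have Et t : t \in T -> E.[t] != 0.
  move=> tT; rewrite second_kind_node// mulf_neq0 ?nodal_but_neq0// gt_eqF//.
  by case: (TW _ tT).
have E0 : E != 0.
  case: T T0 @E Et {uT TW} => // t T _ E Et; apply: contraTneq (Et t (mem_head _ _)) => ->.
  by rewrite horner0 eqxx.
(* With [V = E] and [K = 1], taking [y = E^-1] reduces the sign condition to [0 < W t]; since [K]
   has size 1, [size T - 1] zeros result. *)
have [||||||U [uU sU UE]] := @zeros_of_nodes R J Jconv T E 1 (fun t => E.[t]^-1) 1 (size T).-1 uT.
- by move=> t /TW[].
- exact: E0.
- exact: size_second_kind.
- by move=> t tT; rewrite hornerC mulfV ?Et.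
- move=> t tT; rewrite mul1r second_kind_node// invfM -mulrA mulVf ?nodal_but_neq0//.
  by rewrite mulr1 invr_gt0; case: (TW _ tT).
- by right; rewrite size_poly1 add1n prednK.
have [||e e0 EE] := @factor_of_roots R U E uU E0.
- by rewrite sU prednK// size_second_kind.
- by move=> u /UE[].
by exists e, U; split=> // u /UE[].
Qed.

(** At a zero [u] of the numerator the Wronskian reduces to the numerator's derivative times [(nodal
    T).[u]]. This is the sign needed once the zeros of the numerator serve as nodes. *)
Lemma second_kind_wronskian_lt0 T W (e : R) (U : seq R) u : (0 < size T)%N ->
  uniq T -> (forall t, t \in T -> 0 < W t) -> uniq U ->
  second_kind T W = e *: nodal U -> u \in U ->
  e * (nodal_but U u).[u] * (nodal T).[u] < 0.
Proof.
move=> T0 uT TW uU EE uinU.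
have Eu : (second_kind T W).[u] = 0.
  by rewrite EE hornerZ (rootP _) ?mulr0// root_nodal.
have E'u : (second_kind T W)^`().[u] = e * (nodal_but U u).[u].
  rewrite EE derivZ hornerZ (nodal_butE uU uinU) derivM derivXsubC mulr1.
  by rewrite hornerD hornerM hornerXsubC subrr mulr0 add0r.
have := congr1 (fun p : {poly R} => p.[u]) (wronskian_second_kind W uT).
rewrite hornerD !hornerN !hornerM Eu mul0r subr0 E'u horner_sum => ->.
rewrite oppr_lt0; case: T T0 uT TW EE Eu {E'u} => // t T _ uT TW _ Eu.
have uT' : u \notin t :: T.
  apply/negP => uT1; move: Eu; rewrite second_kind_node// => /eqP.
  by rewrite mulf_eq0 (negPf (nodal_but_neq0 _ _)) gt_eqF// TW.
rewrite big_cons ltr_pwDl//.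
  rewrite hornerZ horner_exp mulr_gt0 ?TW ?mem_head//.
  by rewrite exprn_even_gt0//= -rootE root_nodal_but (negPf uT').
rewrite big_seq sumr_ge0// => v vT; rewrite hornerZ horner_exp mulr_ge0 ?sqr_ge0//.
by rewrite ltW// TW// inE vT orbT.
Qed.

End Nodes.

(** * Algebraic core: from interpolation conditions to zeros *)

Section Core.
Variables (R : rcfType) (J : R -> Prop).
Hypothesis Jconv : forall a b z, J a -> J b -> a <= z <= b -> J z.
Variable L : {poly R} -> R.
Hypothesis Llin : forall (a : R) (f g : {poly R}), L (a *: f + g) = a * L f + L g.
Hypothesis Lpos : forall g, g != 0 -> (forall t, J t -> 0 <= g.[t]) -> 0 < L g.
Variables (N n1 n2 : nat) (xs : seq R) (kappa : R) (A B : {poly R}).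
Hypotheses (xs_uniq : uniq xs) (xs_size : size xs = N)
  (xsJ : forall x, x \in xs -> ~ J x)
  (kappaQ : forall t, J t -> 0 < kappa * (nodal xs).[t])
  (NE : N.+1 = (n1 + n2)%N) (sA : (size A <= n1)%N) (sB : (size B <= n2)%N)
  (AB0 : (A, B) != (0, 0))
  (interp : forall x, x \in xs ->
     A.[x] + B.[x] * (kappa * L (nodal_but xs x)) = 0).

(** After multiplication by [nodal T], the conditions at [xs] say that [nodal xs] divides
    [A * nodal T - B * second_kind T W]; [K] is the quotient, and its size is read off from the two
    products. *)
Lemma interpolation_remainder : exists (T U : seq R) (W : R -> R) (e : R) (K : {poly R}),
  [/\ [/\ uniq T, size T = N.+1 & forall t, t \in T -> J t /\ 0 < W t],
      [/\ e != 0, uniq U, size U = N, forall u, u \in U -> J u &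
        second_kind T W = e *: nodal U],
      A * nodal T - B * second_kind T W = K * nodal xs &
      K = 0 \/ (size K + N <= maxn (n1 + N.+1) (n2 + N))%N].
Proof.
have [T [w [uT sT Tw quad]]] := gauss_quadrature Jconv Llin Lpos N.+1.
(* As [(nodal_but xs x).[t] = (nodal xs).[t] / (t - x)], absorbing [nodal xs] into the weights turns
   the quadrature sum into a discrete Cauchy transform; [kappa] makes the weights positive. *)
pose W t := kappa * w t * (nodal xs).[t].
have TW t : t \in T -> J t /\ 0 < W t.
  by move=> /Tw[Jt wt]; split=> //; rewrite /W mulrAC mulr_gt0// kappaQ.
have [|e [U [e0 uU sU UJ EE]]] := second_kind_roots _ Jconv uT TW; first by rewrite sT.
rewrite sT /= in sU.
have [|K KE] := @dvd_nodal R xs (A * nodal T - B * second_kind T W) xs_uniq.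
  move=> x xin; rewrite hornerD hornerN !hornerM.
  suff -> : (second_kind T W).[x] = - (kappa * L (nodal_but xs x)) * (nodal T).[x].
    by rewrite mulNr mulrN opprK mulrA -mulrDl interp// mul0r.
  rewrite quad; last by rewrite size_nodal_but// xs_size addSnnS leq_addr.
  rewrite horner_sum mulr_sumr -sumrN mulr_suml big_seq [RHS]big_seq.
  apply: eq_bigr => t tT; rewrite hornerZ /W.
  rewrite (nodal_butE xs_uniq xin) (nodal_butE uT tT) !hornerM !hornerXsubC; ring.
exists T, U, W, e, K; split=> //.
have [->|K0] := eqVneq K 0; [by left|right].
have := congr1 (fun p : {poly R} => size p) KE.
rewrite /= size_Mmonic ?nodal_monic// size_nodal xs_size addnS /= => <-.
rewrite (leq_trans (size_polyD _ _))// size_polyN.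
rewrite geq_max !leq_max; apply/andP; split.
  apply/orP; left; rewrite (leq_trans (size_polyMleq _ _))// size_nodal sT addnS /=.
  by rewrite leq_add2r.
apply/orP; right; rewrite (leq_trans (size_polyMleq _ _))//.
have := size_second_kind W uT; rewrite sT => sE.
by rewrite -[X in (_ <= X)%N]/(_.+1.-1) -addnS -!subn1 leq_sub2r// leq_add.
Qed.

(** With [D = nodal T], [E = second_kind T W] and [Q = nodal xs], the remainder identity at a zero
    of [D] reads [- B E = K Q]. There [- E / Q] has the sign of [- kappa] times the derivative of
    [D], so [zeros_of_nodes] applies. *)
Lemma second_zeros : (n2 <= n1 + 1)%N -> n2 <> 0%N ->
  B != 0 /\ exists l, [/\ uniq l, size l = n2.-1 & forall z, z \in l -> J z /\ B.[z] = 0].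
Proof.
move=> n21 n20.
have B0 : B != 0.
  apply: contra_neqN AB0 => // /eqP B0.
  rewrite B0 (@eq0_of_many_roots R xs A)//; first by rewrite xs_size (leq_trans sA)//; lia.
  by move=> x /interp; rewrite B0 horner0 mul0r addr0.
split=> //.
have [T [U [W [e [K [[uT sT TW] _ KE sK]]]]]] := interpolation_remainder.
apply: (@zeros_of_nodes R J Jconv T B K
  (fun t => - (second_kind T W).[t] / (nodal xs).[t]) (- kappa)) => //.
- by move=> t /TW[].
- by rewrite sT (leq_trans sB)//; lia.
- move=> t tT; have [Jt _] := TW _ tT.
  have Q0 : (nodal xs).[t] != 0.
    by apply: contraTneq (kappaQ Jt) => ->; rewrite mulr0 ltxx.
  have := congr1 (fun p : {poly R} => p.[t]) KE.
  rewrite hornerD hornerN !hornerM (rootP (_ : root (nodal T) t)) ?root_nodal//.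
  by rewrite mulr0 add0r -mulrN mulrA => ->; rewrite mulfK.
- move=> t tT; have [Jt Wt] := TW _ tT; have k0 := kappaQ Jt.
  have Q0 : (nodal xs).[t] != 0.
    by apply: contraTneq k0 => ->; rewrite mulr0 ltxx.
  rewrite second_kind_node//.
  rewrite (_ : _ * _ = kappa * (nodal xs).[t] * W t * (nodal_but T t).[t] ^+ 2 /
      (nodal xs).[t] ^+ 2).
    apply: divr_gt0; last by rewrite exprn_even_gt0.
    by apply: mulr_gt0; [exact: mulr_gt0|rewrite exprn_even_gt0//= nodal_but_neq0].
  by field.
(* As [n2 <= n1 + 1], the bound reads [size K <= n1 + 1], hence [size K + (n2 - 1) <= N + 1]. *)
- case: sK => [|sK]; [by left|right]; rewrite sT; lia.
Qed.

(** The nodes are now the zeros of [E = second_kind T W], where the remainder identity reads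
    [A D = K Q]; the Wronskian supplies the sign of [D] there. *)
Lemma first_zeros : (n1 + 1 <= n2)%N -> n1 <> 0%N ->
  A != 0 /\ exists l, [/\ uniq l, size l = n1.-1 & forall z, z \in l -> J z /\ A.[z] = 0].
Proof.
move=> n12 n10.
have [T [U [W [e [K [[uT sT TW] [e0 uU sU UJ EE] KE sK]]]]]] := interpolation_remainder.
(* If [A = 0], then [B * second_kind T W] vanishes on [xs]. The zeros of the second factor lie in
   [J], which [xs] avoids, so [B] would have [N] zeros. *)
have A0 : A != 0.
  apply: contra_neqN AB0 => // /eqP A0.
  rewrite A0 (@eq0_of_many_roots R xs B)//; first by rewrite xs_size (leq_trans sB)//; lia.
  move=> x xin; have := congr1 (fun p : {poly R} => p.[x]) KE.
  rewrite hornerD hornerN !hornerM A0 horner0 mul0r sub0r.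
  rewrite (rootP (_ : root (nodal xs) x)) ?root_nodal// mulr0 => /eqP.
  rewrite oppr_eq0 EE hornerZ !mulf_eq0 (negPf e0) /= => /orP[/eqP//|].
  by rewrite -rootE root_nodal => /UJ /(xsJ xin).
split=> //.
apply: (@zeros_of_nodes R J Jconv U A K
  (fun t => (nodal T).[t] / (nodal xs).[t]) (- kappa * e)) => //.
- by rewrite sU (leq_trans sA)//; lia.
- move=> u uin; have Jt := UJ _ uin.
  have Q0 : (nodal xs).[u] != 0.
    by apply: contraTneq (kappaQ Jt) => ->; rewrite mulr0 ltxx.
  have := congr1 (fun p : {poly R} => p.[u]) KE.
  rewrite hornerD hornerN !hornerM EE hornerZ (rootP (_ : root (nodal U) u)) ?root_nodal//.
  by rewrite !mulr0 subr0 mulrA => ->; rewrite mulfK.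
- move=> u uin; have Jt := UJ _ uin; have k0 := kappaQ Jt.
  have Q0 : (nodal xs).[u] != 0.
    by apply: contraTneq k0 => ->; rewrite mulr0 ltxx.
  have := @second_kind_wronskian_lt0 R T W e U u _ uT _ uU EE uin.
  rewrite sT => /(_ isT (fun t tT => proj2 (TW t tT))) => neg.
  rewrite (_ : _ * _ = kappa * (nodal xs).[u] *
      - (e * (nodal_but U u).[u] * (nodal T).[u]) / (nodal xs).[u] ^+ 2).
    apply: divr_gt0; last by rewrite exprn_even_gt0.
    by apply: mulr_gt0 => //; rewrite oppr_gt0.
  by field.
(* Here [n1 + 1 <= n2] gives [size K <= n2], and [n2 + (n1 - 1)] is exactly the number [N] of
   nodes. *)
- case: sK => [|sK]; [by left|right]; rewrite sU; lia.
Qed.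

End Core.

(** By the degree bound [l] exhausts the zeros, so [p] is a constant times distinct real linear
    factors, and this factorization carries over to the complex numbers. *)
Lemma simple_real_zeros_of_roots (R : realType) (E : set R) (p : {poly R}) (l : seq R) :
  p != 0 -> (size p <= (size l).+1)%N -> uniq l ->
  (forall z, z \in l -> E z /\ p.[z] = 0) -> simple_real_zeros_in E p.
Proof.
move=> p0 sp ul lE.
have [z /lE[]//|c c0 pE] := factor_of_roots ul p0 sp.
pose lC := map (real_complex R) l.
have inj : injective (real_complex R) by exact: fmorph_inj.
have cE : complexify p = (real_complex R c) *: nodal lC.
  rewrite /complexify pE map_polyZ; congr (_ *: _).
  rewrite /nodal rmorph_prod big_map; apply: eq_bigr => u _; exact: map_polyXsubC.
have rootE z : root (complexify p) z -> z \in lC.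
  by rewrite cE rootZ ?root_nodal// fmorph_eq0.
have rt z : root (complexify p) z -> exists2 x, E x & z = real_complex R x.
  by move=> /rootE /mapP[x /lE[Ex _] ->]; exists x.
split=> // z rz; first by have [x _ ->] := rt _ rz; exists x.
rewrite cE -mul_polyC mupMr ?rootC ?fmorph_eq0// mu_prod_XsubC.
by rewrite count_uniq_mem ?map_inj_uniq// rootE.
Qed.

(** * Integration against a measure given by a density *)

Section Density.
Context d (T : measurableType d) (R : realType).
Variables (nu mu : {finite_measure set T -> \bar R}) (h : T -> R).
Hypothesis hint : mu.-integrable setT (EFin \o h).
Hypothesis nuE : forall A, measurable A -> nu A = (\int[mu]_(x in A) (h x)%:E)%E.

(** Uniqueness of the Radon-Nikodym derivative identifies [h] almost everywhere with two versions of
    it: [g] yields integrability of the product, [r] the change of variables. *)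
Lemma integrable_density (f : T -> R) : nu.-integrable setT (EFin \o f) ->
  mu.-integrable setT (EFin \o (fun x => f x * h x)) /\
  \int[nu]_x f x = \int[mu]_x (f x * h x).
Proof.
have numu : nu `<< mu.
  apply/null_content_dominatesP => A mA muA; rewrite nuE// null_set_integral//.
  exact: measurable_funS measurableT (@subsetT _ _) (measurable_int _ hint).
pose g := Radon_Nikodym_SigmaFinite.f nu mu.
have gint : mu.-integrable setT g := Radon_Nikodym_SigmaFinite.f_integrable numu.
have mh := measurable_int _ hint.
have mg := measurable_int _ gint.
pose r := Radon_Nikodym (charge_of_finite_measure nu) mu.
have rint : mu.-integrable setT r by exact: Radon_Nikodym_integrable.
have mr := measurable_int _ rint.
have hr : ae_eq mu setT r (EFin \o h).
  by apply: integral_ae_eq => // A _ mA; rewrite -nuE// -Radon_Nikodym_integral.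
have hg : ae_eq mu setT (EFin \o h) g.
  apply: integral_ae_eq => // A _ mA.
  by rewrite -nuE// -Radon_Nikodym_SigmaFinite.f_integral.
move=> fint; have mf := measurable_int _ fint.
have /measurable_EFinP mfh : measurable_fun setT (f \* h).
  by apply: measurable_funM; exact/measurable_EFinP.
have fhint : mu.-integrable setT (EFin \o (fun x => f x * h x)).
  have := Radon_Nikodym_SigmaFinite.integrableM numu _ measurableT (integrable_abse fint).
  move=> /(_ (fun=> abse_ge0 _)) /integrableP[m1 m2].
  apply/integrableP; split => //.
  apply: le_lt_trans m2; rewrite le_eqVlt; apply/orP; left; apply/eqP.
  apply: ae_eq_integral => //.
  - exact: measurableT_comp.
  - exact: measurableT_comp.
  case: hg => N [mN N0 sub]; exists N; split=> // x /= nx; apply: sub => /= H; apply: nx => _.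
  rewrite abseM normrM EFinM /= normr_id -[in RHS]/g; congr (_ * _)%E.
  by rewrite -(H I).
split=> //; rewrite /Rintegral; congr fine.
rewrite -(Radon_Nikodym_change_of_variables numu measurableT fint).
apply: ae_eq_integral => //.
- exact: emeasurable_funM.
case: hr => N [mN N0 sub]; exists N; split=> // x /= nx; apply: sub => /= H; apply: nx => _.
by rewrite EFinM; congr (_ * _)%E; exact: H I.
Qed.

End Density.

(** * Constant-sign measures: densities, supports, positive integrals *)

Section ConstantSign.
Variable R : realType.
Implicit Types (mu sigma : csmeasure R) (p q : {poly R}).
Local Open Scope classical_set_scope.

Lemma csm_sign_sqr mu : csm_sign mu * csm_sign mu = 1.
Proof. by rewrite /csm_sign -expr2 sqrr_sign. Qed.

Lemma csm_sign_neq0 mu : csm_sign mu != 0.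
Proof. by rewrite signr_eq0. Qed.

Lemma csm_int_density mu sigma (h : R -> R) :
  (csm_abs sigma).-integrable setT (EFin \o h) ->
  (forall A : set (measurableTypeR R), measurable A ->
     csm_val mu A = (csm_int sigma A h)%:E) ->
  forall f : R -> R, (csm_abs mu).-integrable setT (EFin \o f) ->
  (csm_abs sigma).-integrable setT (EFin \o (fun x => f x * h x)) /\
  csm_int mu setT f = csm_int sigma setT (fun x => f x * h x).
Proof.
move=> hint muE f fint.
(* [s * h] is the density of [csm_abs mu] with respect to [csm_abs sigma], and [s] is its own
   inverse. *)
pose s := csm_sign mu * csm_sign sigma.
have ss : s * s = 1 by rewrite /s mulrACA !csm_sign_sqr mulr1.
have intZ (k : R) (g : R -> R) : (csm_abs sigma).-integrable setT (EFin \o g) ->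
    (csm_abs sigma).-integrable setT (EFin \o (fun x => k * g x)).
  exact: (integrableZl measurableT).
have [A mA|fhint fhE] := @integrable_density _ (measurableTypeR R) R (csm_abs mu)
    (csm_abs sigma) (fun x => s * h x) (intZ _ _ hint) _ f fint.
  have hA : (csm_abs sigma).-integrable A (EFin \o h) by exact: integrableS hint.
  have -> : csm_abs mu A = ((csm_sign mu)%:E * csm_val mu A)%E.
    by rewrite /csm_val muleA -EFinM csm_sign_sqr mul1e.
  rewrite muE// /csm_int -EFinM mulrA -/s -RintegralZl// /Rintegral fineK//.
  exact: (integrable_fin_num mA (integrableS measurableT mA _ (intZ s _ hint))).
have fhE' : (fun x => f x * h x) = (fun x => s * (f x * (s * h x))).
  by apply/funext => x; rewrite [f x * (s * _)]mulrCA [RHS]mulrA ss mul1r.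
split; first by rewrite fhE'; exact: intZ.
rewrite fhE' /csm_int RintegralZl// mulrA fhE; congr (_ * _).
by rewrite /s mulrCA csm_sign_sqr mulr1.
Qed.

Lemma integrable_horner sigma p :
  (forall k : nat, (csm_abs sigma).-integrable setT (fun x : R => (x ^+ k)%:E)) ->
  (csm_abs sigma).-integrable setT (EFin \o horner p).
Proof.
move=> H.
have -> : EFin \o horner p = (fun x => \sum_(i < size p) (p`_i)%:E * (x ^+ i)%:E)%E.
  apply/funext => x /=; rewrite horner_coef -sumEFin; apply: eq_bigr => i _.
  by rewrite EFinM.
by apply: integrable_sum => // i _; exact: integrableZl.
Qed.

(** A point outside the support lies in a null interval with rational endpoints, and there are
    countably many of these. *)
Lemma negligible_setC_support sigma :
  (csm_abs sigma).-negligible (~` csm_support sigma).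
Proof.
pose F (k : nat) : set (measurableTypeR R) :=
  if (unpickle k : option (rat * rat)%type) is Some (a, b) then
    if csm_abs sigma `]ratr a, ratr b[ == 0%E then `]ratr a, ratr b[ else set0
  else set0.
apply: (@negligibleS _ _ _ _ (\bigcup_k F k)); last first.
  apply: negligible_bigcup => k; rewrite /F.
  case: unpickle => [[a b]|]; last exact: negligible_set0.
  case: ifPn => [/eqP ab0|_]; last exact: negligible_set0.
  by exists `]ratr a, ratr b[; split => //; exact: measurable_itv.
move=> x /= xs.
have [U [oU Ux U0]] : exists U : set R, [/\ open U, U x & csm_abs sigma U = 0%E].
  apply: contrapT => nU; apply: xs => U oU Ux.
  rewrite lt_neqAle measure_ge0 andbT; apply/negP => /eqP U0.
  by apply: nU; exists U.
have /nbhs_ballP[e /= e0 eU] : nbhs x U by exact: open_nbhs_nbhs.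
have [a] := @rat_in_itvoo R (x - e) x (ltac:(by rewrite ltrBlDr ltrDl)).
rewrite in_itv /= => /andP[ea ax].
have [b] := @rat_in_itvoo R x (x + e) (ltac:(by rewrite ltrDl)).
rewrite in_itv /= => /andP[xb be].
refine (ex_intro2 _ _ (pickle (a, b)) I _); rewrite /F pickleK.
have sub : `]ratr a, ratr b[ `<=` U.
  move=> y /=; rewrite in_itv /= => /andP[ay yb]; apply: eU.
  rewrite /ball /= ltr_distlC; apply/andP; split; first exact: lt_trans ay.
  exact: lt_trans be.
have -> : csm_abs sigma `]ratr a, ratr b[ = 0%E.
  apply/eqP; rewrite -measure_le0 -U0 le_measure ?inE//.
  exact: open_measurable.
by rewrite eqxx /= in_itv /= ax.
Qed.

(** Were the integral zero, [g] would vanish almost everywhere; the open complement of [l] would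
    then be null and the support contained in the finite list [l]. *)
Lemma integral_gt0_of_support sigma (S : set R) (l : seq R) (g : R -> R) :
  infinite_set (csm_support sigma) ->
  {ae csm_abs sigma, forall x, S x} ->
  (csm_abs sigma).-integrable setT (EFin \o g) ->
  (forall x, S x -> 0 <= g x) ->
  (forall x, S x -> g x = 0 -> x \in l) ->
  0 < \int[csm_abs sigma]_x g x.
Proof.
move=> infs aeS gint g0 gl.
have mg := measurable_int _ gint.
have mag : measurable_fun setT (fun x => `|(g x)%:E|)%E by exact: measurableT_comp.
have E : (\int[csm_abs sigma]_x (g x)%:E = \int[csm_abs sigma]_x `|(g x)%:E|)%E.
  apply: ae_eq_integral => //.
  case: aeS => N [mN N0 subN]; exists N; split=> // x /= nx; apply: subN => /= Sx.
  by apply: nx => _; rewrite /= ger0_norm ?g0.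
rewrite lt_neqAle eq_sym; apply/andP; split; last first.
  by rewrite /Rintegral E fine_ge0// integral_ge0.
apply/negP => /eqP int0.
have /(ae_eq_integral_abs _ measurableT mg) gae0 :
    (\int[csm_abs sigma]_x `|(g x)%:E| = 0)%E.
  rewrite -E -[LHS]fineK; last exact: integrable_fin_num gint.
  by congr EFin.
apply: infs; apply: (@sub_finite_set _ _ [set` l]); last exact: finite_seq.
move=> x sx /=; apply/negPn/negP => xl.
have ol : open (~` [set` l]).
  by apply: closed_openC; apply: compact_closed;
    [exact: norm_hausdorff|exact: finite_compact (finite_seq l)].
have := sx _ ol; rewrite /= => /(_ (negP xl)); rewrite lt_neqAle => /andP[/eqP + _].
apply; apply/esym/negligibleP; first exact: open_measurable.
pose A : set (measurableTypeR R) := ~` S `|` ~` [set x | g x = 0].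
apply: (@negligibleS _ _ _ _ A) => [y /= yl|].
  by apply/not_andP => -[Sy gy]; apply: yl; exact: gl.
apply: negligibleU; first exact: aeS.
case: gae0 => N [mN N0 subN]; exists N; split=> // y /= gy; apply: subN => /= H.
by apply: gy; case: (H I).
Qed.

End ConstantSign.

(** * The Cauchy transform on a segment whose interior carries no mass *)

Section CauchySegment.
Variable R : realType.
Local Open Scope classical_set_scope.

Lemma measurable_subV (x : R) : measurable_fun setT (fun t : R => (t - x)^-1).
Proof.
have -> : [set: R] = ~` [set x] `|` [set x] by rewrite setvU.
apply/measurable_funU => //; first exact: measurableC.
split; last exact: measurable_fun_set1.
apply: open_continuous_measurable_fun.
  by apply: closed_openC; exact: closed_eq.
move=> t /set_mem /= /eqP tx; apply: cvgV; first by rewrite subr_eq0.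
by apply: cvgB; [exact: cvg_id|exact: cvg_cst].
Qed.

(** The point of the segment closest to [t] is an endpoint, so the kernels at the endpoints dominate
    uniformly in [x]. *)
Lemma norm_subV_le (a b x t : R) : t < a \/ b < t -> a <= x <= b ->
  `|(t - x)^-1| <= `|(t - a)^-1| + `|(t - b)^-1|.
Proof.
move=> tab /andP[ax xb]; rewrite !normfV; case: tab => [ta|bt].
  rewrite (@le_trans _ _ `|t - a|^-1)//; last by rewrite lerDl invr_ge0.
  have tx : t < x by exact: lt_le_trans ax.
  rewrite !ltr0_norm ?subr_lt0// !opprB lef_pV2 ?posrE ?subr_gt0//; lra.
rewrite (@le_trans _ _ `|t - b|^-1)//; last by rewrite lerDr invr_ge0.
have xt : x < t by exact: le_lt_trans bt.
rewrite !gtr0_norm ?subr_gt0// lef_pV2 ?posrE ?subr_gt0//; lra.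
Qed.

Variables (sigma : csmeasure R) (a b : R).
Hypotheses (ab : a <= b) (sab : csm_abs sigma `]a, b[ = 0%E)
  (ca : cauchy_defined sigma a) (cb : cauchy_defined sigma b).

Lemma ae_notin_segment : {ae csm_abs sigma, forall t : R, t < a \/ b < t}.
Proof.
pose N : set (measurableTypeR R) := [set a] `|` `]a, b[ `|` [set b].
apply: (@negligibleS _ _ _ _ N) => [t /= nt|].
  rewrite /N /= in_itv /=.
  have [ta|ta|->] := ltgtP t a; [by case: nt; left| |by left; left].
  have [tb|tb|->] := ltgtP t b; [by left; right|by case: nt; right|by right].
apply: negligibleU; [apply: negligibleU|].
- by exists [set a]; split => //; case: ca.
- by exists `]a, b[; split => //; exact: measurable_itv.
- by exists [set b]; split => //; case: cb.
Qed.

Lemma integrable_segment_bound :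
  (csm_abs sigma).-integrable setT (EFin \o (fun t => `|(t - a)^-1| + `|(t - b)^-1|)).
Proof.
have [_ ia] := ca; have [_ ib] := cb.
have := integrableD measurableT (integrable_norm ia) (integrable_norm ib).
by apply: eq_integrable.
Qed.

Lemma cauchy_defined_segment x : a <= x <= b -> cauchy_defined sigma x.
Proof.
move=> xab; split.
  apply/negligibleP; first exact: measurable_set1.
  apply: negligibleS ae_notin_segment => t /= ->.
  by case/andP: xab => ax xb; case; rewrite ltNge ?ax ?xb.
have mx := measurable_subV x.
apply/integrableP; split; first exact/measurable_EFinP.
have /integrableP[mg ig] := integrable_segment_bound.
apply: le_lt_trans ig; apply: ae_ge0_le_integral => //.
- by apply: measurableT_comp => //; exact/measurable_EFinP.
- by apply: measurableT_comp.
apply: negligibleS ae_notin_segment => t /= nt ot; apply: nt => _.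
by rewrite lee_fin [leRHS]ger0_norm ?addr_ge0//; exact: norm_subV_le.
Qed.

(** Projection onto the segment: composing with it gives a function continuous on the whole line, so
    the endpoints need no one-sided limits. *)
Let clamp (x : R) := Num.max a (Num.min b x).

Let clamp_segment x : a <= clamp x <= b.
Proof. by rewrite /clamp le_max lexx /= ge_max ab ge_min lexx. Qed.

Let clamp_id x : a <= x <= b -> clamp x = x.
Proof.
by case/andP => ax xb; rewrite /clamp min_r// max_r.
Qed.

Let clamp_continuous : continuous clamp.
Proof.
apply: (@max_fun_continuous _ _ _ (cst a) (cst b \min id)).
  by move=> x; exact: cvg_cst.
apply: min_fun_continuous => x; [exact: cvg_cst|exact: cvg_id].
Qed.

Lemma cauchy_transform_clamp_continuous : continuous (cauchy_transform sigma \o clamp).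
Proof.
move=> x; apply: cvgM; first exact: cvg_cst.
have H := @continuity_under_integral R _ (measurableTypeR R) (csm_abs sigma)
  (fun x t => (t - clamp x)^-1) setT measurableT (x - 1) (x + 1).
have := H _ _ (fun t => `|(t - a)^-1| + `|(t - b)^-1|) integrable_segment_bound.
apply => //.
- by move=> y _; case: (cauchy_defined_segment (clamp_segment y)).
- apply: negligibleS ae_notin_segment => t /= nt ot; apply: nt => _ y _.
  apply: cvgV; last by apply: cvgB; [exact: cvg_cst|exact: clamp_continuous].
  rewrite subr_eq0; apply/eqP => tE; have := clamp_segment y.
  by rewrite -tE => /andP[h1 h2]; case: ot; rewrite ltNge ?h1 ?h2.
- move=> y _; apply: negligibleS ae_notin_segment => t /= nt ot; apply: nt => _.
  exact: norm_subV_le.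
- by rewrite inE /= in_itv /=; apply/andP; split; lra.
Qed.

(** The points [a] and [b] may belong to the support of [sigma], as can happen when the two
    intervals touch; convergence there is enough for continuity up to the endpoints. *)
Lemma cauchy_transform_ivt (A B : {poly R}) :
  let F x := A.[x] + B.[x] * cauchy_transform sigma x in
  F a * F b < 0 -> exists2 z, a <= z <= b & F z = 0.
Proof.
move=> F Fab.
have cF : {within `[a, b], continuous (F \o clamp)}.
  apply: continuous_subspaceT => x; apply: cvgD.
    by apply: (@continuous_comp _ _ _ clamp (horner A));
      [exact: clamp_continuous|exact: continuous_horner].
  apply: cvgM; last exact: cauchy_transform_clamp_continuous.
  by apply: (@continuous_comp _ _ _ clamp (horner B));
    [exact: clamp_continuous|exact: continuous_horner].
have [] := @IVT R (F \o clamp) a b 0 ab cF.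
  rewrite /= !clamp_id ?lexx ?ab// ge_min le_max.
  have [Fa|Fa|Fa] := ltgtP (F a) 0.
  - by move: Fab; rewrite nmulr_rlt0//= => /ltW.
  - by move: Fab; rewrite pmulr_rlt0//= => /ltW ->.
  - by move: Fab; rewrite Fa mul0r ltxx.
by move=> z /[!in_itv]/= zab; rewrite /= clamp_id// => Fz; exists z.
Qed.

End CauchySegment.

(** * Intervals and their interiors *)

Section Intervals.
Variable R : realType.
Implicit Types (G U : set R).
Local Open Scope classical_set_scope.

Lemma interior_segment G (a b z : R) :
  is_interval G -> G a -> G b -> a < z < b -> interior G z.
Proof.
move=> iG Ga Gb zab; apply: (@filterS _ (nbhs z) _ `]a, b[).
  by move=> y /=; rewrite in_itv /= => /andP[ay yb]; apply: (iG a b) => //; rewrite !ltW.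
by apply: open_nbhs_nbhs; split; [exact: interval_open|rewrite /= in_itv].
Qed.

(** The point [y] makes the interval nondegenerate. The witness moves from [x] towards [y] by half
    the smaller of their distance and the radius of a ball inside [U]. *)
Lemma interior_near G U (x y : R) : is_interval G -> G x -> G y -> y != x ->
  nbhs x U -> exists2 z, interior G z & U z.
Proof.
move=> iG Gx Gy yx /nbhs_ballP[e /= e0 eU].
have [lyx|lxy|E] := ltgtP y x; last by rewrite E eqxx in yx.
- have d0 : 0 < Num.min (x - y) e by rewrite lt_min subr_gt0 lyx.
  have d1 : Num.min (x - y) e <= x - y by rewrite ge_min lexx.
  have d2 : Num.min (x - y) e <= e by rewrite ge_min lexx orbT.
  exists (x - Num.min (x - y) e / 2).
    by apply: (@interior_segment _ y x) => //; apply/andP; split; lra.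
  by apply: eU; rewrite /ball /= opprB addrC subrK gtr0_norm; lra.
- have d0 : 0 < Num.min (y - x) e by rewrite lt_min subr_gt0 lxy.
  have d1 : Num.min (y - x) e <= y - x by rewrite ge_min lexx.
  have d2 : Num.min (y - x) e <= e by rewrite ge_min lexx orbT.
  exists (x + Num.min (y - x) e / 2).
    by apply: (@interior_segment _ x y) => //; apply/andP; split; lra.
  by apply: eU; rewrite /ball /= opprD addNKr normrN gtr0_norm; lra.
Qed.

Lemma interior_convex G (a b z : R) : is_interval G ->
  interior G a -> interior G b -> a <= z <= b -> interior G z.
Proof.
move=> iG Ga Gb /andP[]; rewrite le_eqVlt => /predU1P[<-//|az].
rewrite le_eqVlt => /predU1P[->//|zb].
by apply: (@interior_segment _ a b) => //;
  [exact: interior_subset|exact: interior_subset|rewrite az].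
Qed.

Lemma infinite_set_neq G (x : R) : infinite_set G -> exists2 y, G y & y != x.
Proof.
move=> infG; apply: contrapT => nG; apply: infG.
apply: (@sub_finite_set _ _ [set x]); last exact: finite_set1.
by move=> y Gy /=; apply/eqP/negPn/negP => yx; apply: nG; exists y.
Qed.

Lemma disjoint_interior G1 G2 x : is_interval G1 -> infinite_set G1 ->
  interior G1 `&` interior G2 = set0 -> G1 x -> ~ interior G2 x.
Proof.
move=> i1 inf1 G12 G1x G2x.
have [y G1y yx] := infinite_set_neq x inf1.
have [|z z1 z2] := @interior_near G1 (interior G2) x y i1 G1x G1y yx.
  exact: nbhs_interior.
by have : (interior G1 `&` interior G2) z by []; rewrite G12.
Qed.

Lemma horner_ge0_interior G (p : {poly R}) : is_interval G -> infinite_set G ->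
  (forall t, interior G t -> 0 <= p.[t]) -> forall t, G t -> 0 <= p.[t].
Proof.
move=> iG infG p0 t Gt; rewrite leNgt; apply/negP => pt.
have [y Gy yt] := infinite_set_neq t infG.
have [|z zG /= pz] := @interior_near G [set z | p.[z] < 0] t y iG Gt Gy yt.
  exact: (@continuous_horner R p t _ (open_nbhs_nbhs (conj (@open_lt R 0) pt))).
by have := p0 _ zG; rewrite leNgt pz.
Qed.

Lemma exists_roots (p : {poly R}) : p != 0 -> exists l : seq R, forall x, root p x -> x \in l.
Proof.
move: {2}(size p) (leqnn (size p)) => n; elim: n p => [|n IH] p sp p0.
  by rewrite leqn0 size_poly_eq0 (negPf p0) in sp.
case: (pselect (exists x, root p x)) => [[x /factor_theorem[q pE]]|nx]; last first.
  by exists [::] => x rx; case: nx; exists x.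
have q0 : q != 0 by apply: contraNneq p0 => q0; rewrite pE q0 mul0r.
have [|l ql] := IH q _ q0.
  by move: sp; rewrite pE size_Mmonic ?monicXsubC// size_XsubC addn2.
by exists (x :: l) => y; rewrite pE rootM root_XsubC inE orbC => /orP[->//|/ql->]; rewrite orbT.
Qed.

End Intervals.

(** * The type I function of a Nikishin system and its zeros *)

Section Nikishin.
Variable R : realType.
Variables (Gamma1 Gamma2 : set R) (sigma1 sigma2 mu1 mu2 : csmeasure R).
Hypothesis hN : nikishin Gamma1 Gamma2 sigma1 sigma2 mu1 mu2.
Variables (n1 n2 : nat) (A1 A2 : {poly R}).
Hypothesis hA : type1_mop mu1 mu2 n1 n2 A1 A2.
Local Open Scope classical_set_scope.

Let F x := A1.[x] + A2.[x] * cauchy_transform sigma2 x.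
(** Where the integral diverges, [cauchy_transform] has no meaningful value; such points are null
    for [sigma1]. *)
Let S : set R := [set x | Gamma1 x /\ cauchy_defined sigma2 x].
Let N := (n1 + n2).-1.

Lemma csm_class_infinite Gamma (sigma : csmeasure R) :
  csm_class Gamma sigma -> infinite_set Gamma.
Proof. by case=> _ inf sub fin; apply: inf; exact: sub_finite_set fin. Qed.

(** Both measures have densities with respect to [sigma1], namely [1] and the Cauchy transform of
    [sigma2]. *)
Lemma type1_function_moment k :
  (csm_abs sigma1).-integrable setT (EFin \o (fun x => F x * x ^+ k)) /\
  type1_moment mu1 mu2 A1 A2 k = csm_int sigma1 setT (fun x => F x * x ^+ k).
Proof.
have [[_ _ _ _ [[m1 _ _] [m2 _ _]]] [mu1E _ mint mu2E]] := hN.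
have hor (p : {poly R}) : (fun x => p.[x] * x ^+ k) = horner (p * 'X^k).
  by apply/funext => x; rewrite hornerM hornerXn.
have cst1 : (csm_abs sigma1).-integrable setT (EFin \o cst (1 : R)).
  exact: finite_measure_integrable_cst.
have mu1E' (A : set (measurableTypeR R)) : measurable A ->
    csm_val mu1 A = (csm_int sigma1 A (cst 1))%:E.
  move=> mA; rewrite mu1E// /csm_int Rintegral_cst// mul1r /csm_val EFinM fineK//.
  exact: fin_num_measure.
have [i1 E1] := csm_int_density cst1 mu1E' (integrable_horner (A1 * 'X^k) m1).
have [i2 E2] := csm_int_density mint mu2E (integrable_horner (A2 * 'X^k) m2).
have FE : (fun x => F x * x ^+ k) =
    (fun x => (A1 * 'X^k).[x] * cst 1 x + (A2 * 'X^k).[x] * cauchy_transform sigma2 x).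
  by apply/funext => x; rewrite /F !hornerM hornerXn /=; ring.
split; first by rewrite FE; exact: (integrableD measurableT i1 i2).
by rewrite /type1_moment !hor E1 E2 FE /csm_int RintegralD// mulrDr.
Qed.

Lemma type1_function_orthogonal (q : {poly R}) : (size q <= N)%N ->
  (csm_abs sigma1).-integrable setT (EFin \o (fun x => F x * q.[x])) /\
  \int[csm_abs sigma1]_x (F x * q.[x]) = 0.
Proof.
have [_ _ _ m0 _] := hA.
pose P (q : {poly R}) :=
  (csm_abs sigma1).-integrable setT (EFin \o (fun x => F x * q.[x])) /\
  \int[csm_abs sigma1]_x (F x * q.[x]) = 0.
move=> sq; rewrite -/(P q) -[q]coefK poly_def; apply: big_ind.
- have FE : (fun x => F x * (0 : {poly R}).[x]) = cst 0.
    by apply/funext => x; rewrite horner0 mulr0.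
  rewrite /P FE; split; first exact: finite_measure_integrable_cst.
  by rewrite Rintegral_cst// mul0r.
- move=> f g [if1 f0] [ig g0].
  have FE : (fun x => F x * (f + g).[x]) = (fun x => F x * f.[x] + F x * g.[x]).
    by apply/funext => x; rewrite hornerD mulrDr.
  rewrite /P FE; split; first exact: (integrableD measurableT if1 ig).
  by rewrite RintegralD// f0 g0 addr0.
- move=> k _; have [ik Ek] := type1_function_moment k.
  have FE : (fun x => F x * (q`_k *: 'X^k).[x]) = (fun x => q`_k * (F x * x ^+ k)).
    by apply/funext => x; rewrite hornerZ hornerXn mulrCA.
  rewrite /P FE; split; first exact: (integrableZl measurableT _ ik).
  (* [k < size q <= (n1 + n2).-1] gives [k.+1 < n1 + n2], the range in which the moments vanish. *)
  rewrite RintegralZl//; move: Ek; rewrite m0; last first.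
    have := leq_trans (ltn_ord k) sq; rewrite /N; case: (n1 + n2)%N => // m; exact.
  move/esym/eqP; rewrite /csm_int mulf_eq0 (negPf (csm_sign_neq0 _)) /= => /eqP ->.
  by rewrite mulr0.
Qed.

(** The segment lies in the interior of [Gamma1], which misses [Gamma2] and with it the support of
    [sigma2]. *)
Lemma open_segment_null a b : Gamma1 a -> Gamma1 b ->
  csm_abs sigma2 `]a, b[ = 0%E.
Proof.
have [[[i1 _] [i2 _] int12 [s1 s2] _] _] := hN.
move=> Ga Gb; apply/negligibleP; first exact: measurable_itv.
apply: negligibleS (negligible_setC_support sigma2) => x /=.
rewrite in_itv /= => axb sx; have [_ _ sub] := s2.
have := interior_segment i1 Ga Gb axb.
by apply: (disjoint_interior i2 (csm_class_infinite s2) _ (sub _ sx)); rewrite setIC.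
Qed.

(** With fewer than [N] zeros, [F * q] would be nonnegative on [S] for some [q] of size at most [N]
    and have positive integral, against orthogonality. *)
Lemma type1_function_zeros : exists xs, [/\ uniq xs, size xs = N &
  forall z, z \in xs -> S z /\ F z = 0].
Proof.
have [[[i1 _] [i2 _] int12 [s1 s2] _] [_ aes _ _]] := hN.
have [a b [Ga ca] [Gb cb] ab Fab|//|[q [q0 sq rq Fq [l lF]]]] := @zeros_or_sign_poly R N S F.
  have nul := open_segment_null Ga Gb.
  have [z zab Fz] := cauchy_transform_ivt (ltW ab) nul ca cb Fab.
  (* Convergence at [a] and [b] spreads to the whole segment, so the zero lies in [S]. *)
  exists z; split=> //; split; first exact: i1 zab.
  exact: cauchy_defined_segment zab.
have [iFq Fq0] := type1_function_orthogonal sq.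
have [_ infs sub] := s1.
have := @integral_gt0_of_support R sigma1 S l (fun x => F x * q.[x]) infs _ iFq Fq.
rewrite Fq0 ltxx => H; exfalso; apply/negP: isT; apply: H.
- pose A : set (measurableTypeR R) :=
    ~` csm_support sigma1 `|` ~` [set x | cauchy_defined sigma2 x].
  apply: (@negligibleS _ _ _ _ A) => [x /= nS|].
    by apply/not_andP => -[sx cx]; apply: nS; split => //; exact: sub.
  by apply: negligibleU; [exact: negligible_setC_support|exact: aes].
- move=> x Sx /eqP; rewrite mulf_eq0 => /orP[/eqP|/rq[]]; first exact: lF.
  by move=> _ Fx; exact: lF.
Qed.

End Nikishin.

(* The polynomial part plus the partial fractions of [g / nodal xs]: unlike the quotient itself it
   is linear in [g] and manifestly integrable, and it differs from it only at the points of [xs]. *)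
Definition quotient_fun (R : realType) (xs : seq R) (g : {poly R}) (t : R) : R :=
  (g %/ nodal xs).[t] + \sum_(x <- xs) g.[x] / (nodal_but xs x).[x] * (t - x)^-1.

(** * Integration of quotients by [nodal xs] *)

Section QuotientFun.
Variables (R : realType) (xs : seq R).
Hypothesis xs_uniq : uniq xs.
Implicit Types (g h : {poly R}).
Local Open Scope classical_set_scope.

Lemma quotient_funE g t : t \notin xs -> quotient_fun xs g t = g.[t] / (nodal xs).[t].
Proof.
move=> txs; have Q0 : (nodal xs).[t] != 0 by rewrite -rootE root_nodal.
apply: (mulIf Q0); rewrite divfK//.
have sr : (size (g %% nodal xs)%R <= size xs)%N.
  by rewrite -ltnS -(size_nodal xs) ltn_modp monic_neq0// nodal_monic.
rewrite {2}(divp_eq g (nodal xs)) hornerD hornerM /quotient_fun mulrDl; congr (_ + _).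
rewrite [in RHS](lagrange xs_uniq sr) horner_sum mulr_suml big_seq [RHS]big_seq.
apply: eq_bigr => x xin.
have rx : (g %% nodal xs).[x] = g.[x].
  rewrite [in RHS](divp_eq g (nodal xs)) hornerD hornerM.
  by rewrite (rootP (_ : root (nodal xs) x)) ?root_nodal// mulr0 add0r.
rewrite hornerZ rx; set c := g.[x] / _; rewrite -mulrA; congr (_ * _).
rewrite (nodal_butE xs_uniq xin) hornerM hornerXsubC mulrCA mulVf ?mulr1//.
by rewrite subr_eq0; apply: contraNneq txs => ->.
Qed.

Lemma quotient_fun_linear a g h t :
  quotient_fun xs (a *: g + h) t = a * quotient_fun xs g t + quotient_fun xs h t.
Proof.
rewrite /quotient_fun divpD divpZl hornerD hornerZ mulrDr addrACA; congr (_ + _).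
rewrite mulr_sumr -big_split; apply: eq_bigr => x _ /=.
by rewrite hornerD hornerZ; ring.
Qed.

Lemma quotient_fun_nodal_but x t : x \in xs ->
  quotient_fun xs (nodal_but xs x) t = (t - x)^-1.
Proof.
move=> xin; rewrite /quotient_fun divp_small ?horner0 ?add0r; last first.
  by rewrite size_nodal_but// size_nodal.
rewrite (bigD1_seq x)//= divff ?nodal_but_neq0// mul1r big1_seq ?addr0// => y /andP[yx yin].
have /rootP -> : root (nodal_but xs x) y by rewrite root_nodal_but yin.
by rewrite !mul0r.
Qed.

Lemma integrable_quotient_fun (sigma : csmeasure R) g :
  (forall k : nat, (csm_abs sigma).-integrable setT (fun x : R => (x ^+ k)%:E)) ->
  (forall x, x \in xs -> cauchy_defined sigma x) ->
  (csm_abs sigma).-integrable setT (EFin \o quotient_fun xs g).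
Proof.
move=> mom xsd.
have -> : EFin \o quotient_fun xs g = (EFin \o horner (g %/ nodal xs)) \+
    (fun t => \sum_(x <- xs | x \in xs) (g.[x] / (nodal_but xs x).[x])%:E * ((t - x)^-1)%:E)%E.
  apply/funext => t; rewrite /= -big_seq; under eq_bigr do rewrite -EFinM.
  by rewrite sumEFin.
apply: (integrableD measurableT); first exact: integrable_horner.
apply: integrable_sum => // x xin; apply: integrableZl => //.
by have [] := xsd _ xin.
Qed.

End QuotientFun.

(** By the intermediate value theorem [nodal xs] has constant sign on the interior of [Gamma]. The
    factor [(nodal xs).[t0]] corrects that sign; its inverse is the [kappa] of the algebraic
    core. *)
Lemma quotient_functional (R : realType) (Gamma : set R) (sigma : csmeasure R)
    (xs : seq R) (t0 : R) :
  is_interval Gamma -> csm_class Gamma sigma -> uniq xs -> interior Gamma t0 ->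
  (forall x, x \in xs -> cauchy_defined sigma x /\ ~ interior Gamma x) ->
  let L g := (nodal xs).[t0] * \int[csm_abs sigma]_t quotient_fun xs g t in
  [/\ forall (a : R) (f g : {poly R}), L (a *: f + g) = a * L f + L g,
      forall t, interior Gamma t -> 0 < (nodal xs).[t0]^-1 * (nodal xs).[t] &
      forall g, g != 0 -> (forall t, interior Gamma t -> 0 <= g.[t]) -> 0 < L g].
Proof.
move=> iG cs uxs Gt0 xsG L.
have [mom infs sub] := cs; have infG := csm_class_infinite cs.
have intg g : (csm_abs sigma).-integrable setT (EFin \o quotient_fun xs g).
  by apply: integrable_quotient_fun => // x /xsG[].
have Q0 t : interior Gamma t -> (nodal xs).[t] != 0.
  by move=> Gt; rewrite -rootE root_nodal; apply/negP => /xsG[_].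
have QQ t : interior Gamma t -> 0 < (nodal xs).[t0] * (nodal xs).[t].
  move=> Gt; rewrite lt_neqAle eq_sym mulf_neq0 ?Q0//= leNgt; apply/negP => neg.
  have root_between a b : interior Gamma a -> interior Gamma b -> a <= b ->
      (nodal xs).[a] * (nodal xs).[b] < 0 -> False.
    move=> Ga Gb ab Qab.
    have [|z zab] := @poly_ivt R (nodal xs * (nodal xs).[b]%:P) a b ab.
      by rewrite !hornerM !hornerC -expr2 sqr_ge0 andbT ltW.
    rewrite rootM rootC (negPf (Q0 _ Gb)) orbF => /rootP Qz.
    by have := Q0 _ (interior_convex iG Ga Gb zab); rewrite Qz eqxx.
  have [t0t|/ltW tt0] := leP t0 t; first exact: root_between neg.
  by apply: (root_between t t0) => //; rewrite mulrC.
split.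
- move=> a f g; rewrite /L.
  have -> : quotient_fun xs (a *: f + g) = fun t => a * quotient_fun xs f t + quotient_fun xs g t.
    by apply/funext => t; exact: quotient_fun_linear.
  rewrite RintegralD//; last exact: (integrableZl measurableT _ (intg f)).
  by rewrite RintegralZl//; ring.
- move=> t Gt; rewrite -(pmulr_rgt0 _ (_ : 0 < (nodal xs).[t0] ^+ 2)); last first.
    by rewrite exprn_even_gt0//= Q0.
  by rewrite expr2 -mulrA mulVKf ?Q0// QQ.
- move=> g g0 gG.
  pose p := (nodal xs).[t0] *: nodal xs.
  (* The support may contain endpoints of [Gamma], so the sign conditions are extended from the
     interior by continuity. *)
  have gE t : Gamma t -> 0 <= g.[t] by exact: horner_ge0_interior.
  have pE t : Gamma t -> 0 <= p.[t].
    by apply: horner_ge0_interior => // u Gu; rewrite hornerZ ltW// QQ.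
  have [l gl] := exists_roots g0.
  rewrite /L -RintegralZl//.
  apply: (@integral_gt0_of_support R sigma [set t | Gamma t /\ t \notin xs] l) => //.
  + pose A : set (measurableTypeR R) := (~` csm_support sigma `|` [set` xs])%classic.
    apply: (@negligibleS _ _ _ _ A) => [t /= nS|].
      have [txs|txs] := boolP (t \in xs); [by right|left => st].
      by apply: nS; split=> //; exact: sub.
    apply: negligibleU; first exact: negligible_setC_support.
    (* The points of [xs] carry no mass, because [cauchy_defined] excludes atoms. *)
    have -> : [set` xs]%classic = (\big[setU/set0]_(x <- xs | x \in xs) [set x])%classic.
      rewrite -big_seq -bigcup_seq; apply/seteqP; split=> [t tx|t [y yx ->]//].
      by exists t.
    apply: big_ind => [|X Y nX nY|x xin]; [exact: negligible_set0|exact: negligibleU|].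
    by exists [set x]%classic; split => //; have [[]] := xsG _ xin.
  + exact: (integrableZl measurableT _ (intg g)).
  + move=> t [Gt txs]; rewrite quotient_funE//.
    have Qt : (nodal xs).[t] != 0 by rewrite -rootE root_nodal.
    have -> : (nodal xs).[t0] * (g.[t] / (nodal xs).[t]) = p.[t] * g.[t] / (nodal xs).[t] ^+ 2.
      by rewrite hornerZ; field.
    by rewrite !mulr_ge0 ?invr_ge0 ?sqr_ge0 ?pE ?gE.
  + move=> t [Gt txs] /eqP; rewrite quotient_funE// !mulf_eq0 (negPf (Q0 _ Gt0)) /=.
    by rewrite invr_eq0 => /orP[/gl//|]; rewrite -rootE root_nodal (negPf txs).
Qed.

Theorem theorem4p13 (R : realType) (Gamma1 Gamma2 : set R)
    (sigma1 sigma2 mu1 mu2 : csmeasure R) (n1 n2 : nat) (A1 A2 : {poly R})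
    (hN : nikishin Gamma1 Gamma2 sigma1 sigma2 mu1 mu2)
    (hn : (n1, n2) <> (0%N, 0%N))
    (hA : type1_mop mu1 mu2 n1 n2 A1 A2) :
  ((n1 + 1 <= n2)%N -> n1 <> 0%N ->
     simple_real_zeros_in (interior Gamma2) A1) /\
  ((n2 <= n1 + 1)%N -> n2 <> 0%N ->
     simple_real_zeros_in (interior Gamma2) A2).
Proof.
have [[[i1 _] [i2 _] int12 [s1 s2] _] _] := hN.
have [A0 sA1 sA2 _ _] := hA.
have [xs [uxs sxs xsS]] := type1_function_zeros hN hA.
have inf1 := csm_class_infinite s1.
have inf2 := csm_class_infinite s2.
have [t0 Gt0] : exists t, interior Gamma2 t.
  have [x Gx] : exists x, Gamma2 x.
    apply: contrapT => nG; apply: inf2.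
    by rewrite (_ : Gamma2 = set0)%classic// -subset0 => x Gx; apply: nG; exists x.
  have [y Gy yx] := infinite_set_neq x inf2.
  have [|z Gz _] := @interior_near R Gamma2 setT x y i2 Gx Gy yx; last by exists z.
  exact: filterT.
have xsG x : x \in xs -> cauchy_defined sigma2 x /\ ~ interior Gamma2 x.
  by move=> /xsS[[G1x cx] _]; split=> //; exact: disjoint_interior int12 G1x.
have [Llin kQ Lpos] := quotient_functional i2 s2 uxs Gt0 xsG.
have Jconv a b z := @interior_convex R Gamma2 a b z i2.
have NE : (n1 + n2).-1.+1 = (n1 + n2)%N.
  rewrite prednK// lt0n addn_eq0; apply/negP => /andP[/eqP n10 /eqP n20].
  by apply: hn; rewrite n10 n20.
(* The functional integrates against [csm_abs sigma2], so the sign of [sigma2] is moved to [A2]. *)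
pose B := csm_sign sigma2 *: A2.
have B0 : (B == 0) = (A2 == 0) by rewrite scaler_eq0 (negPf (csm_sign_neq0 _)).
have sB : size B = size A2 by rewrite size_scale// csm_sign_neq0.
have AB0 : (A1, B) != (0, 0) by rewrite xpair_eqE B0 -xpair_eqE.
(* The normalization cancels and [nodal_but xs x] becomes the Cauchy kernel, so this is the
   vanishing of the type I function at [x]. *)
have interp x : x \in xs -> A1.[x] + B.[x] * ((nodal xs).[t0]^-1 *
    ((nodal xs).[t0] * \int[csm_abs sigma2]_t quotient_fun xs (nodal_but xs x) t)) = 0.
  move=> xin; have [_ Fx] := xsS _ xin; rewrite -[RHS]Fx; congr (_ + _).
  rewrite mulKf; last by rewrite -rootE root_nodal; apply/negP => /xsG[_].
  rewrite /B hornerZ /cauchy_transform /csm_int [RHS]mulrCA mulrA; congr (_ * _).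
  by apply: eq_Rintegral => t _; rewrite quotient_fun_nodal_but.
rewrite -sB in sA2.
have xsJ x : x \in xs -> ~ interior Gamma2 x by move=> /xsG[].
split=> h1 h2.
- have [A10 [l [ul sl lA]]] :=
    first_zeros Jconv Llin Lpos uxs sxs xsJ kQ NE sA1 sA2 AB0 interp h1 h2.
  apply: (simple_real_zeros_of_roots A10 _ ul lA).
  by rewrite sl prednK// lt0n; apply/eqP.
- have [B00 [l [ul sl lB]]] := second_zeros Jconv Llin Lpos uxs sxs kQ NE sA1 sA2 AB0 interp h1 h2.
  have A20 : A2 != 0 by rewrite -B0.
  apply: (simple_real_zeros_of_roots A20 _ ul) => [|z /lB[Gz Bz]].
    by rewrite sl prednK ?lt0n -?sB//; apply/eqP.
  split=> //; apply/eqP; move/eqP: Bz.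
  by rewrite hornerZ mulf_eq0 (negPf (csm_sign_neq0 _)).
Qed.
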